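(* Let $\Sigma\subseteq\Pi_X=\Pi_{X'}\times\Pi_{X''}$. (1) If $\preceq$ is smooth and satisfies (GH3), then $(\mu*2)$ holds, and thus $(S*2)$ holds. (2) Put $\Sigma'=\Sigma\restriction X'$, $\Sigma''=\Sigma\restriction X''$ (it is not assumed that $\Sigma=\Sigma'\times\Sigma''$). If $\preceq$ is smooth and satisfies (GH3), then: $\mu(\Sigma')\times\mu(\Sigma'')\subseteq\Sigma$ $\Rightarrow$ $\mu(\Sigma)=\mu(\Sigma')\times\mu(\Sigma'')$. (3) If $\preceq$ satisfies (GH3) and $\Sigma=\Sigma'\times\Sigma''$ (with $\Sigma'=\Sigma\restriction X'$, $\Sigma''=\Sigma\restriction X''$), then $\mu(\Sigma)=\mu(\Sigma')\times\mu(\Sigma'')$; i.e. $(\mu*1)$ holds, and thus $(S*1)$ holds. (4) If $\preceq$ is smooth and satisfies (GH3), then $(\mu*3)$ holds, and thus $(S*3)$ holds. (5) $(\mu*1)$ and $(\mu*2)$ characterize (GH3) among smooth relations: if $\prec$ is smooth (with $\sigma\prec\tau$ iff $\tau\notin\mu(\{\sigma,\tau\})$), then $\preceq$ satisfies (GH3) if and only if $\mu$ satisfies $(\mu*1)$ and $(\mu*2)$. (6) Let $\sigma\prec\tau\Leftrightarrow\tau\notin\mu(\{\sigma,\tau\})$ and let $\prec$ be smooth. Then $\mu$ satisfies $(\mu*1)$ (equivalently, $(s*s)$) iff $\prec$ is a GH relation. (7) Let $\Gamma'\subseteq\Sigma'$, $\Gamma''\subseteq\Sigma''$ ($\Sigma'\subseteq\Pi_{X'}$,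 $\Sigma''\subseteq\Pi_{X''}$), let $\Gamma'\times\Gamma''\subseteq\Sigma'\times\Sigma''$ be small, and let (GH2) hold. Then $\Gamma'\subseteq\Sigma'$ is small or $\Gamma''\subseteq\Sigma''$ is small. (8) Let $\Gamma'\subseteq\Sigma'$ be small, $\Gamma''\subseteq\Sigma''$, and let (GH1) hold. Then $\Gamma'\times\Gamma''\subseteq\Sigma'\times\Sigma''$ is small.
   Context: Let $X=X'\cup X''$ be a disjoint union of index sets, with a set $X_i$ for each $i\in X$; $\Pi_Y=\prod_{i\in Y}X_i$ for $Y\subseteq X$, and $\Pi_X$ is identified with $\Pi_{X'}\times\Pi_{X''}$; elements of $\Pi_X$ are written $\sigma=\sigma'\sigma''$ with $\sigma'\in\Pi_{X'}$, $\sigma''\in\Pi_{X''}$. $\Sigma\restriction Y=\{\sigma\restriction Y:\sigma\in\Sigma\}$. On each of $\Pi_{X'},\Pi_{X''},\Pi_X$ a relation, always denoted $\preceq$, is given, with $\sigma\prec\tau$ iff $\sigma\preceq\tau$ and $\sigma\ne\tau$, and $\sigma\preceq\tau$ iff $\sigma\prec\tau$ or $\sigma=\tau$ (so $\preceq$ is reflexive). For $A$ a subset of one of these spaces, $\mu(A)=\{a\in A:\neg\exists b\in A\; b\prec a\}$. $B\subseteq A$ is big iff $\mu(A)\subseteq B$, and small iff $A\setminus B$ is big. The relation is smooth if for each such $A$ and $a\in A$, either $a\in\mu(A)$ or there is $b\in\mu(A)$ with $b\prec a$. (GH3): $\sigma'\sigma''\preceq\tau'\tau''$ iff $\sigma'\preceq\tau'$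 and $\sigma''\preceq\tau''$. (GH1): if $\sigma'\preceq\tau'$, $\sigma''\preceq\tau''$ and ($\sigma'\prec\tau'$ or $\sigma''\prec\tau''$), then $\sigma'\sigma''\prec\tau'\tau''$. (GH2): if $\sigma'\sigma''\prec\tau'\tau''$ then $\sigma'\prec\tau'$ or $\sigma''\prec\tau''$. A GH (general Hamming) relation is one satisfying (GH1) and (GH2). Conditions (for all $\Sigma'\subseteq\Pi_{X'}$, $\Sigma''\subseteq\Pi_{X''}$, $\Sigma\subseteq\Pi_X$ not necessarily a product; $Y$ is either of $X',X''$): $(S*1)$ $\Delta\subseteq\Sigma'\times\Sigma''$ is big iff there are big $\Gamma'\subseteq\Sigma'$, $\Gamma''\subseteq\Sigma''$ with $\Gamma'\times\Gamma''\subseteq\Delta$. $(S*2)$ $\Gamma\subseteq\Sigma$ big $\Rightarrow$ $\Gamma\restriction Y\subseteq\Sigma\restriction Y$ big. $(S*3)$ $A\subseteq\Sigma$ big $\Rightarrow$ there is a big $B\subseteq\Pi_{X'}\times(\Sigma\restriction X'')$ with $B\restriction X''\subseteq A\restriction X''$. $(\mu*1)$ $\mu(\Sigma'\times\Sigma'')=\mu(\Sigma')\times\mu(\Sigma'')$. $(\mu*2)$ $\mu(\Sigma)\subseteq\Gamma$ $\Rightarrow$ $\mu(\Sigma\restriction Y)\subseteq\Gamma\restriction Y$. $(\mu*3)$ $\mu(\Pi_{X'}\times(\Sigma\restriction X''))\restriction X''\subseteq\mu(\Sigma)\restriction X''$. $(s*s)$ for $\Gamma'\subseteq\Sigma'$,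 $\Gamma''\subseteq\Sigma''$: $\Gamma'\times\Gamma''\subseteq\Sigma'\times\Sigma''$ is small iff $\Gamma'\subseteq\Sigma'$ is small or $\Gamma''\subseteq\Sigma''$ is small. *)

(* Defs.v *)
From mathcomp Require Import all_boot.
From mathcomp Require Import boolp classical_sets.

Set Implicit Arguments.
Unset Strict Implicit.
Unset Printing Implicit Defensive.

Local Open Scope classical_set_scope.

Section Relation.
Variables (T : Type) (le : T -> T -> Prop).

Definition lt (s t : T) : Prop := le s t /\ s <> t.

Definition le_lt_or_eq : Prop := forall s t, le s t <-> lt s t \/ s = t.

Definition mu (A : set T) : set T :=
  [set a | A a /\ ~ exists2 b, A b & lt b a].

(* [bigin A B]: B is a big subset of A; both predicates include [B `<=` A]. *)
Definition bigin (A B : set T) : Prop := B `<=` A /\ mu A `<=` B.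

Definition smallin (A B : set T) : Prop := B `<=` A /\ bigin A (A `\` B).

Definition smooth : Prop :=
  forall (A : set T) (a : T), A a -> mu A a \/ exists2 b, mu A b & lt b a.

(* As [mu] is computed from [lt], this holds for every relation; it records
   the convention that [lt] and [mu] determine each other. *)
Definition lt_from_mu : Prop :=
  forall s t, lt s t <-> ~ mu [set s; t] t.

End Relation.

(* The disjoint union of the index sets X' and X'' is the sum type I1 + I2;
   F is the family of factors. Restriction of a sequence to X' or X'' is
   precomposition with [inl] or [inr]. *)
Section Sequences.
Variables (I1 I2 : Type) (F : I1 + I2 -> Type).

Definition Pi1 : Type := forall i : I1, F (inl i).
Definition Pi2 : Type := forall i : I2, F (inr i).
Definition PiX : Type := forall i : I1 + I2, F i.

Definition restr1 (s : PiX) : Pi1 := fun i => s (inl i).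
Definition restr2 (s : PiX) : Pi2 := fun i => s (inr i).

Definition glue (s1 : Pi1) (s2 : Pi2) : PiX :=
  fun i => match i with inl i1 => s1 i1 | inr i2 => s2 i2 end.

Lemma restr1_glue (s1 : Pi1) (s2 : Pi2) : restr1 (glue s1 s2) = s1.
Proof. by []. Qed.

Lemma restr2_glue (s1 : Pi1) (s2 : Pi2) : restr2 (glue s1 s2) = s2.
Proof. by []. Qed.

Lemma glue_restr (s : PiX) : glue (restr1 s) (restr2 s) = s.
Proof. by apply: functional_extensionality_dep => -[]. Qed.

Definition sprod (S1 : set Pi1) (S2 : set Pi2) : set PiX :=
  [set s | S1 (restr1 s) /\ S2 (restr2 s)].

End Sequences.

Arguments restr1 {I1 I2 F} s i.
Arguments restr2 {I1 I2 F} s i.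

Section Conditions.
Variables (I1 I2 : Type) (F : I1 + I2 -> Type).
Variables (le1 : Pi1 F -> Pi1 F -> Prop) (le2 : Pi2 F -> Pi2 F -> Prop)
          (le : PiX F -> PiX F -> Prop).

Definition GH3 : Prop := forall s1 s2 t1 t2,
  le (glue s1 s2) (glue t1 t2) <-> le1 s1 t1 /\ le2 s2 t2.

Definition GH1 : Prop := forall s1 s2 t1 t2,
  le1 s1 t1 -> le2 s2 t2 -> lt le1 s1 t1 \/ lt le2 s2 t2 ->
  lt le (glue s1 s2) (glue t1 t2).

Definition GH2 : Prop := forall s1 s2 t1 t2,
  lt le (glue s1 s2) (glue t1 t2) -> lt le1 s1 t1 \/ lt le2 s2 t2.

Definition GH : Prop := GH1 /\ GH2.

Definition smooth_all : Prop := [/\ smooth le1, smooth le2 & smooth le].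

Definition lt_from_mu_all : Prop :=
  [/\ lt_from_mu le1, lt_from_mu le2 & lt_from_mu le].

Definition Sstar1 : Prop :=
  forall (S1 : set (Pi1 F)) (S2 : set (Pi2 F)) (D : set (PiX F)),
  D `<=` sprod S1 S2 ->
  (bigin le (sprod S1 S2) D <->
   exists G1 G2, [/\ bigin le1 S1 G1, bigin le2 S2 G2 & sprod G1 G2 `<=` D]).

Definition Sstar2 : Prop := forall S G : set (PiX F),
  bigin le S G ->
  bigin le1 (restr1 @` S) (restr1 @` G) /\
  bigin le2 (restr2 @` S) (restr2 @` G).

Definition Sstar3 : Prop := forall S A : set (PiX F),
  bigin le S A ->
  exists2 B, bigin le (sprod setT (restr2 @` S)) B &
             restr2 @` B `<=` restr2 @` A.

Definition mustar1 : Prop := forall (S1 : set (Pi1 F)) (S2 : set (Pi2 F)),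
  mu le (sprod S1 S2) = sprod (mu le1 S1) (mu le2 S2).

Definition mustar2 : Prop := forall S G : set (PiX F),
  mu le S `<=` G ->
  mu le1 (restr1 @` S) `<=` restr1 @` G /\
  mu le2 (restr2 @` S) `<=` restr2 @` G.

Definition mustar3 : Prop := forall S : set (PiX F),
  restr2 @` mu le (sprod setT (restr2 @` S)) `<=`
  restr2 @` mu le S.

Definition sstars : Prop :=
  forall (S1 G1 : set (Pi1 F)) (S2 G2 : set (Pi2 F)),
  G1 `<=` S1 -> G2 `<=` S2 ->
  (smallin le (sprod S1 S2) (sprod G1 G2) <->
   smallin le1 S1 G1 \/ smallin le2 S2 G2).

End Conditions.

(* Main.v *)
Require Import Defs.
From mathcomp Require Import all_boot.
From mathcomp Require Import boolp classical_sets.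

(** Everything rests on the inclusions between [mu (S1 x S2)] and
    [mu S1 x mu S2], one for each half of the Hamming condition.  (GH1) lets a
    strict improvement of one coordinate be completed, by leaving the other
    one alone, to a strict improvement of the whole sequence; so a minimal
    point of a product has minimal coordinates ([mu_sprod_sub]).  (GH2) reads a
    strict improvement of a sequence back in a coordinate; so minimal
    coordinates make a minimal point ([sprod_mu_sub], which compares coordinates
    only and so also applies to a set and its projections).  As smallness of
    [B] in [A] means that [B] misses [mu A], and a rectangle is empty iff one of
    its sides is, these inclusions are the two implications of (s*s), and
    testing (s*s) on singletons recovers ([mu]*1).

    Conversely, [mu] on pairs knows the strict relation: [s] is below [t] iff
    [t] is not minimal in [{s, t}].  Applied to [{s1, t1} x {s2, t2}], ([mu]*1)
    gives (GH2) at once, and (GH1) after smoothness has provided a minimal point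
    below the non-minimal [(t1, t2)]: the only candidate is [(s1, s2)].

    (GH3) is (GH1) and (GH2) together with monotonicity of both projections.
    This monotonicity is what handles arbitrary sets [S]: by smoothness each
    point of [S] lies above a minimal one, and projecting that comparison gives
    ([mu]*2) and ([mu]*3).  On pairs, ([mu]*2) gives monotonicity back.  The
    statements about big sets follow because [mu A] is the least big subset
    of [A]. *)

Local Open Scope classical_set_scope.

(** * Minimal elements and small sets *)

Section OneRelation.
Set Implicit Arguments.
Unset Strict Implicit.
Variables (T : Type) (le : T -> T -> Prop).

Lemma le_refl : le_lt_or_eq le -> forall s, le s s.
Proof. by move=> h s; apply/h; right. Qed.

Lemma mu_bigin (A : set T) : bigin le A (mu le A).
Proof. by split=> // a []. Qed.

(** The form of smoothness that is used on arbitrary sets: the two cases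
    merge once the minimal point may be the given one. *)
Lemma smooth_le (A : set T) (a : T) :
  le_lt_or_eq le -> smooth le -> A a -> exists2 b, mu le A b & le b a.
Proof.
move=> h sm /sm [ma|[b mb [ba _]]]; last by exists b.
by exists a => //; apply: le_refl.
Qed.

Lemma mu_le_eq (A : set T) (a b : T) : mu le A a -> A b -> le b a -> b = a.
Proof.
move=> [_ na] Ab ba; apply: contrapT => neq.
by apply: na; exists b.
Qed.

Lemma mu_pair (s t : T) : lt le s t -> mu le [set s; t] `<=` [set s].
Proof.
move=> st x [[//|->] nx]; exfalso; apply: nx.
by exists s => //; left.
Qed.

Lemma not_mu_pair (s t : T) : ~ mu le [set s; t] t -> lt le s t.
Proof.
move=> nt; apply: contrapT => nst; apply: nt.
split; first by right.
by move=> [b [->|->]] // [].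
Qed.

Lemma mu_pair_le (s t : T) : le s t -> mu le [set s; t] `<=` [set s].
Proof.
have [<- _ x [[]//]|neq st] := pselect (s = t).
by apply: mu_pair.
Qed.

Lemma smallinP (A B : set T) :
  smallin le A B <-> B `<=` A /\ forall a, mu le A a -> ~ B a.
Proof.
split=> [[BA [_ mA]]|[BA mA]]; first by split=> // a /mA [].
split=> //; split=> [a []//|a ma]; split; first by case: ma.
exact: mA.
Qed.

Lemma not_smallin (A B : set T) :
  B `<=` A -> ~ smallin le A B -> exists2 a, mu le A a & B a.
Proof.
move=> BA ns; apply: contrapT => na; apply: ns.
by apply/smallinP; split=> // a ma Ba; apply: na; exists a.
Qed.

Lemma smallin_set1 (A : set T) (a : T) :
  A a -> (smallin le A [set a] <-> ~ mu le A a).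
Proof.
move=> Aa; split=> [/smallinP[_ h] ma|nma]; first exact: (h a).
by apply/smallinP; split=> [_ -> //|b mb ba]; apply: nma; rewrite -ba.
Qed.

End OneRelation.

(** * Products *)

Section Product.
Set Implicit Arguments.
Unset Strict Implicit.
Variables (I1 I2 : Type) (F : I1 + I2 -> Type).
Variables (le1 : Pi1 F -> Pi1 F -> Prop) (le2 : Pi2 F -> Pi2 F -> Prop)
          (le : PiX F -> PiX F -> Prop).
Hypotheses (hle1 : le_lt_or_eq le1) (hle2 : le_lt_or_eq le2)
           (hle : le_lt_or_eq le).

Lemma glue_inj (s1 t1 : Pi1 F) (s2 t2 : Pi2 F) :
  glue s1 s2 = glue t1 t2 -> s1 = t1 /\ s2 = t2.
Proof.
by move=> e; split; [apply: (congr1 restr1 e)|apply: (congr1 restr2 e)].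
Qed.

Lemma sprod_set1 (s : PiX F) :
  sprod [set restr1 s] [set restr2 s] = [set s].
Proof.
apply/seteqP; split=> [t /= [e1 e2]|_ -> //].
by rewrite -(glue_restr t) e1 e2 glue_restr.
Qed.

Lemma sub_sprod_image (S : set (PiX F)) :
  S `<=` sprod (restr1 @` S) (restr2 @` S).
Proof. by move=> s Ss; split; exists s. Qed.

Lemma sprodS (S1 G1 : set (Pi1 F)) (S2 G2 : set (Pi2 F)) :
  G1 `<=` S1 -> G2 `<=` S2 -> sprod G1 G2 `<=` sprod S1 S2.
Proof. by move=> GS1 GS2 s [s1 s2]; split; [apply: GS1|apply: GS2]. Qed.

Lemma GH3_restr (s t : PiX F) :
  GH3 le1 le2 le ->
  le s t -> le1 (restr1 s) (restr1 t) /\ le2 (restr2 s) (restr2 t).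
Proof. by move=> h st; apply/h; rewrite !glue_restr. Qed.

Lemma GH3_GH : GH3 le1 le2 le -> GH le1 le2 le.
Proof.
move=> h; split=> [s1 s2 t1 t2 st1 st2 lt12|s1 s2 t1 t2 [/h[st1 st2] neq]].
  split; first by apply/h.
  by move=> /glue_inj [e1 e2]; case: lt12 => -[].
have [e1|n1] := pselect (s1 = t1); last by left.
by right; split=> // e2; apply: neq; rewrite e1 e2.
Qed.

Lemma GH1_lt1 (s1 t1 : Pi1 F) (s2 t2 : Pi2 F) :
  GH1 le1 le2 le -> lt le1 s1 t1 -> le2 s2 t2 ->
  lt le (glue s1 s2) (glue t1 t2).
Proof. by move=> h st1 st2; apply: h => //; [case: st1|left]. Qed.

Lemma GH1_lt2 (s1 t1 : Pi1 F) (s2 t2 : Pi2 F) :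
  GH1 le1 le2 le -> le1 s1 t1 -> lt le2 s2 t2 ->
  lt le (glue s1 s2) (glue t1 t2).
Proof. by move=> h st1 st2; apply: h => //; [case: st2|right]. Qed.

Lemma mu_sprod_sub (S1 : set (Pi1 F)) (S2 : set (Pi2 F)) :
  GH1 le1 le2 le -> mu le (sprod S1 S2) `<=` sprod (mu le1 S1) (mu le2 S2).
Proof.
move=> h s [[Ss1 Ss2] ns]; split; split=> // -[t St ts]; apply: ns.
  exists (glue t (restr2 s)) => //; rewrite -(glue_restr s).
  by apply: GH1_lt1 => //; apply: le_refl.
exists (glue (restr1 s) t) => //; rewrite -(glue_restr s).
by apply: GH1_lt2 => //; apply: le_refl.
Qed.

(** A competitor from [S] would have a strictly better coordinate, and its
    coordinates lie in [S1] and [S2].  Arbitrary [S] are allowed in order to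
    take [S1] and [S2] to be the projections of [S]. *)
Lemma sprod_mu_sub (S1 : set (Pi1 F)) (S2 : set (Pi2 F)) (S : set (PiX F)) :
  GH2 le1 le2 le -> S `<=` sprod S1 S2 ->
  S `&` sprod (mu le1 S1) (mu le2 S2) `<=` mu le S.
Proof.
move=> h SS s [Ss [[_ n1] [_ n2]]]; split=> // -[t /SS[t1 t2]].
rewrite -(glue_restr s) -(glue_restr t) => /h [ts|ts].
  by apply: n1; exists (restr1 t).
by apply: n2; exists (restr2 t).
Qed.

Lemma GH_mustar1 : GH le1 le2 le -> mustar1 le1 le2 le.
Proof.
move=> [h1 h2] S1 S2; apply/seteqP; split; first exact: mu_sprod_sub.
move=> s ms; apply: (sprod_mu_sub h2 (@subset_refl _ _)); split=> //.
by apply: sprodS ms => a [].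
Qed.

(** A strictly better minimal coordinate can be paired with some minimal
    coordinate below the other one, by smoothness; the hypothesis keeps the
    resulting pair in [S]. *)
Lemma mu_eq_sprod_mu (S : set (PiX F)) :
  smooth le1 -> smooth le2 -> GH le1 le2 le ->
  sprod (mu le1 (restr1 @` S)) (mu le2 (restr2 @` S)) `<=` S ->
  mu le S = sprod (mu le1 (restr1 @` S)) (mu le2 (restr2 @` S)).
Proof.
move=> sm1 sm2 [h1 h2] sub; apply/seteqP; split=> [s [Ss ns]|s ms]; last first.
  by apply: (sprod_mu_sub h2 (@sub_sprod_image S)); split=> //; apply: sub.
have [Ss1 Ss2] := sub_sprod_image Ss.
have [t1 m1 ts1] := smooth_le hle1 sm1 Ss1.
have [t2 m2 ts2] := smooth_le hle2 sm2 Ss2.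
suff e : glue t1 t2 = s by rewrite -e.
apply: contrapT => neq; apply: ns; exists (glue t1 t2); first exact: sub.
have [e1|n1] := pselect (t1 = restr1 s); last first.
  by rewrite -(glue_restr s); apply: GH1_lt1.
have [e2|n2] := pselect (t2 = restr2 s); last first.
  by rewrite -(glue_restr s); apply: GH1_lt2.
by exfalso; apply: neq; rewrite e1 e2 glue_restr.
Qed.

(** * From the relation to the conditions on [mu] *)

(** The minimal sequence below one that has a minimal coordinate must have the
    same coordinate. *)
Lemma GH3_mustar2 : smooth le -> GH3 le1 le2 le -> mustar2 le1 le2 le.
Proof.
move=> sm h S G SG; split=> s1 ms1; have [[s Ss es] _] := ms1.
all: have [t mt /(GH3_restr h)[ts1 ts2]] := smooth_le hle sm Ss.
all: exists t; first exact: SG.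
all: apply: (mu_le_eq ms1); last by rewrite -es.
all: by exists t => //; case: mt.
Qed.

Lemma GH3_mustar3 : smooth le -> GH3 le1 le2 le -> mustar3 le.
Proof.
move=> sm h S _ [s ms <-]; have [h1 _] := GH3_GH h.
have [_ ms2] := mu_sprod_sub h1 ms.
have [[r Sr er] _] := ms2.
have [t mt /(GH3_restr h)[_ tr2]] := smooth_le hle sm Sr.
exists t => //; apply: (mu_le_eq ms2); last by rewrite -er.
by exists t => //; case: mt.
Qed.

Lemma mustar1_Sstar1 : mustar1 le1 le2 le -> Sstar1 le1 le2 le.
Proof.
move=> h S1 S2 D DS; split=> [[_]|[G1 [G2 [[_ m1] [_ m2] GD]]]].
  by rewrite h => mD; exists (mu le1 S1), (mu le2 S2); split=> //; apply: mu_bigin.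
split=> //; rewrite h; apply: subset_trans GD; exact: sprodS.
Qed.

Lemma mustar2_Sstar2 : mustar2 le1 le2 le -> Sstar2 le1 le2 le.
Proof.
by move=> h S G [GS /h[m1 m2]]; split; split=> //; apply: image_subset.
Qed.

Lemma mustar3_Sstar3 : mustar3 le -> Sstar3 le.
Proof.
move=> h S A [_ mA]; exists (mu le (sprod setT (restr2 @` S))).
  exact: mu_bigin.
apply: subset_trans (h S) _; exact: image_subset.
Qed.

Lemma GH2_smallin (S1 G1 : set (Pi1 F)) (S2 G2 : set (Pi2 F)) :
  GH2 le1 le2 le -> G1 `<=` S1 -> G2 `<=` S2 ->
  smallin le (sprod S1 S2) (sprod G1 G2) ->
  smallin le1 S1 G1 \/ smallin le2 S2 G2.
Proof.
move=> h GS1 GS2 /smallinP[_ nG].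
have [|n1] := pselect (smallin le1 S1 G1); first by left.
have [|n2] := pselect (smallin le2 S2 G2); first by right.
have [s1 m1 Gs1] := not_smallin GS1 n1.
have [s2 m2 Gs2] := not_smallin GS2 n2.
exfalso; apply: (nG (glue s1 s2)) => //.
by apply: (sprod_mu_sub h (@subset_refl _ _)); split; split=> //;
  [case: m1|case: m2].
Qed.

Lemma GH1_smallin1 (S1 G1 : set (Pi1 F)) (S2 G2 : set (Pi2 F)) :
  GH1 le1 le2 le -> smallin le1 S1 G1 -> G2 `<=` S2 ->
  smallin le (sprod S1 S2) (sprod G1 G2).
Proof.
move=> h /smallinP[GS1 n1] GS2; apply/smallinP; split; first exact: sprodS.
by move=> s /(mu_sprod_sub h)[m1 _] [Gs1 _]; apply: n1 m1 Gs1.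
Qed.

Lemma GH1_smallin2 (S1 G1 : set (Pi1 F)) (S2 G2 : set (Pi2 F)) :
  GH1 le1 le2 le -> G1 `<=` S1 -> smallin le2 S2 G2 ->
  smallin le (sprod S1 S2) (sprod G1 G2).
Proof.
move=> h GS1 /smallinP[GS2 n2]; apply/smallinP; split; first exact: sprodS.
by move=> s /(mu_sprod_sub h)[_ m2] [_ Gs2]; apply: n2 m2 Gs2.
Qed.

Lemma GH_sstars : GH le1 le2 le -> sstars le1 le2 le.
Proof.
move=> [h1 h2] S1 G1 S2 G2 GS1 GS2; split; first exact: GH2_smallin.
by case=> sG; [apply: GH1_smallin1|apply: GH1_smallin2].
Qed.

(** * From the conditions on [mu] to the relation *)

(** The singleton of a sequence is the product of the singletons of its
    coordinates, and it is small exactly when the sequence is not minimal. *)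
Lemma sstars_mustar1 : sstars le1 le2 le -> mustar1 le1 le2 le.
Proof.
move=> h S1 S2; apply/seteqP.
have key s : sprod S1 S2 s ->
    ~ mu le (sprod S1 S2) s <->
    ~ mu le1 S1 (restr1 s) \/ ~ mu le2 S2 (restr2 s).
  move=> Ss; have [Ss1 Ss2] := Ss.
  rewrite -(smallin_set1 _ Ss) -(smallin_set1 _ Ss1) -(smallin_set1 _ Ss2).
  by rewrite -sprod_set1; apply: h => _ ->.
split=> s ms.
  have [Ss _] := ms.
  by split; apply: contrapT => n; move: ms; apply/(key s Ss); [left|right].
have Ss : sprod S1 S2 s by apply: sprodS ms => a [].
by apply: contrapT => /(key s Ss); case: ms => m1 m2 [].
Qed.

Lemma mustar1_GH2 : mustar1 le1 le2 le -> GH2 le1 le2 le.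
Proof.
move=> h s1 s2 t1 t2 st.
have nt : ~ mu le (sprod [set s1; t1] [set s2; t2]) (glue t1 t2).
  by move=> [_]; apply; exists (glue s1 s2) => //; split; left.
have [l1|n1] := pselect (lt le1 s1 t1); first by left.
right; apply: not_mu_pair => m2; apply: nt; rewrite h; split=> //.
by apply: contrapT => nm1; apply: n1 (not_mu_pair nm1).
Qed.

(** Smoothness turns the failure of minimality of [glue t1 t2] in the product of
    the two pairs into a comparison with a minimal element, and these all have
    coordinates [s1] and [s2]. *)
Lemma mustar1_GH1 : smooth le -> mustar1 le1 le2 le -> GH1 le1 le2 le.
Proof.
move=> sm h s1 s2 t1 t2 st1 st2 lt12.
have mu_s r : mu le (sprod [set s1; t1] [set s2; t2]) r -> r = glue s1 s2.
  rewrite h => -[m1 m2]; rewrite -(glue_restr r).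
  by rewrite (mu_pair_le st1 m1) (mu_pair_le st2 m2).
have tP : sprod [set s1; t1] [set s2; t2] (glue t1 t2) by split; right.
case: (sm _ _ tP) => [/mu_s/glue_inj[e1 e2]|[r /mu_s-> //]].
by exfalso; case: lt12 => -[_]; apply.
Qed.

Lemma mustar1_iff_GH : smooth le -> mustar1 le1 le2 le <-> GH le1 le2 le.
Proof.
move=> sm; split; last exact: GH_mustar1.
by move=> h; split; [apply: mustar1_GH1|apply: mustar1_GH2].
Qed.

(** For [s] strictly below [t], the singleton of [s] contains the minimal
    elements of the pair, so by ([mu]*2) each coordinate of [s] does so for the
    projected pair, that is, it lies below the coordinate of [t]. *)
Lemma mustar2_restr (s t : PiX F) :
  mustar2 le1 le2 le -> le s t ->
  le1 (restr1 s) (restr1 t) /\ le2 (restr2 s) (restr2 t).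
Proof.
move=> h st; have := h _ _ (mu_pair_le st).
rewrite !image_set1 !image_setU !image_set1 => -[m1 m2]; split.
  have [->|neq] := pselect (restr1 s = restr1 t); first exact: le_refl.
  by have [] : lt le1 (restr1 s) (restr1 t) by apply: not_mu_pair => /m1 /esym.
have [->|neq] := pselect (restr2 s = restr2 t); first exact: le_refl.
by have [] : lt le2 (restr2 s) (restr2 t) by apply: not_mu_pair => /m2 /esym.
Qed.

Lemma mustar12_GH3 :
  smooth le -> mustar1 le1 le2 le -> mustar2 le1 le2 le -> GH3 le1 le2 le.
Proof.
move=> sm m1 m2 s1 s2 t1 t2; split=> [/(mustar2_restr m2)//|[st1 st2]].
have h1 := mustar1_GH1 sm m1.
have [e1|n1] := pselect (s1 = t1); last by have [] := GH1_lt1 h1 (conj st1 n1) st2.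
have [e2|n2] := pselect (s2 = t2); last by have [] := GH1_lt2 h1 st1 (conj st2 n2).
by rewrite e1 e2; apply: le_refl.
Qed.

End Product.

Theorem proposition5p2p4 (I1 I2 : Type) (F : I1 + I2 -> Type)
  (le1 : Pi1 F -> Pi1 F -> Prop) (le2 : Pi2 F -> Pi2 F -> Prop)
  (le : PiX F -> PiX F -> Prop)
  (hle1 : le_lt_or_eq le1) (hle2 : le_lt_or_eq le2) (hle : le_lt_or_eq le) :
  (* (1) *)
  (smooth_all le1 le2 le -> GH3 le1 le2 le ->
     mustar2 le1 le2 le /\ Sstar2 le1 le2 le) /\
  (* (2) *)
  (smooth_all le1 le2 le -> GH3 le1 le2 le ->
     forall S : set (PiX F),
       let S1 := restr1 @` S in
       let S2 := restr2 @` S in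
       sprod (mu le1 S1) (mu le2 S2) `<=` S ->
       mu le S = sprod (mu le1 S1) (mu le2 S2)) /\
  (* (3) *)
  (GH3 le1 le2 le ->
     [/\ forall S : set (PiX F),
           let S1 := restr1 @` S in
           let S2 := restr2 @` S in
           S = sprod S1 S2 -> mu le S = sprod (mu le1 S1) (mu le2 S2),
         mustar1 le1 le2 le & Sstar1 le1 le2 le]) /\
  (* (4) *)
  (smooth_all le1 le2 le -> GH3 le1 le2 le ->
     mustar3 le /\ Sstar3 le) /\
  (* (5) *)
  (lt_from_mu_all le1 le2 le -> smooth_all le1 le2 le ->
     (GH3 le1 le2 le <-> mustar1 le1 le2 le /\ mustar2 le1 le2 le)) /\
  (* (6) *)
  (lt_from_mu_all le1 le2 le -> smooth_all le1 le2 le ->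
     (mustar1 le1 le2 le <-> sstars le1 le2 le) /\
     (mustar1 le1 le2 le <-> GH le1 le2 le)) /\
  (* (7) *)
  (forall (S1 G1 : set (Pi1 F)) (S2 G2 : set (Pi2 F)),
     G1 `<=` S1 -> G2 `<=` S2 ->
     smallin le (sprod S1 S2) (sprod G1 G2) -> GH2 le1 le2 le ->
     smallin le1 S1 G1 \/ smallin le2 S2 G2) /\
  (* (8) *)
  (forall (S1 G1 : set (Pi1 F)) (S2 G2 : set (Pi2 F)),
     smallin le1 S1 G1 -> G2 `<=` S2 -> GH1 le1 le2 le ->
     smallin le (sprod S1 S2) (sprod G1 G2)).
Proof.
split=> [[sm1 sm2 sm] h|].
  have m2 := GH3_mustar2 hle sm h.
  by split=> //; apply: mustar2_Sstar2.
split=> [[sm1 sm2 sm] h S S1 S2|].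
  by apply: mu_eq_sprod_mu => //; apply: GH3_GH.
split=> [h|].
  have m1 := GH_mustar1 hle1 hle2 (GH3_GH h).
  split; [move=> S S1 S2 eS|exact: m1|exact: mustar1_Sstar1].
  by rewrite {1}eS; apply: m1.
split=> [[sm1 sm2 sm] h|].
  have m3 := GH3_mustar3 hle1 hle2 hle sm h.
  by split=> //; apply: mustar3_Sstar3.
split=> [_ [sm1 sm2 sm]|].
  split=> [h|[]]; last exact: mustar12_GH3.
  by split; [apply: GH_mustar1 => //; apply: GH3_GH|apply: GH3_mustar2].
split=> [_ [sm1 sm2 sm]|].
  have mGH := mustar1_iff_GH hle1 hle2 sm.
  split; last exact: mGH.
  split; last exact: sstars_mustar1.
  by move=> /mGH; apply: GH_sstars.
split=> [S1 G1 S2 G2 GS1 GS2 sG h|S1 G1 S2 G2 sG GS2 h].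
  exact: GH2_smallin sG.
exact: GH1_smallin1 sG GS2.
Qed.
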